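(* Let $p$ be a prime, $r,k,l$ positive integers, and $A\in\mathbb{Z}^{k\times l}$. There exist unimodular matrices $P\in\mathbb{Z}^{k\times k}$ and $Q\in\mathbb{Z}^{(k+l)\times(k+l)}$ such that $$P[A,-p^rI]Q=[S_p,0],$$ where $S_p$ is the $k\times k$ diagonal matrix $S_p=\mathrm{diag}\{p^{r_1},p^{r_2},\dots,p^{r_k}\}$ with integers $0\le r_1\le r_2\le\dots\le r_k$.
   Context: $I$ is the $k\times k$ identity matrix, $[A,-p^rI]$ is the $k\times(k+l)$ block matrix, and an integer square matrix is unimodular if its determinant is $\pm1$. *)

(* Defs.v *)
From mathcomp Require Import all_boot all_order all_algebra.

Set Implicit Arguments.
Unset Strict Implicit.
Unset Printing Implicit Defensive.

Import Order.TTheory GRing.Theory Num.Theory.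
Local Open Scope ring_scope.

Definition unimodular n (M : 'M[int]_n) : Prop := \det M = 1 \/ \det M = -1.

(* The block matrix [A, -q I]. Concatenation produces l + k columns; the cast
   reindexes them, without moving any entry, as k + l columns. *)
Definition block_A_negqI (k l : nat) (A : 'M[int]_(k, l)) (q : int) :
    'M[int]_(k, k + l) :=
  castmx (erefl k, addnC l k) (row_mx A (- q%:M)).

(* Main.v *)
(** Take the Smith normal form [D] of [B = [A, -qI]], [q = p^r].  Since [B] has a
    right inverse up to the factor [q], so does [D]; hence every diagonal entry
    of [D] divides [q] and is, up to sign, a power of [p].  The signs are
    absorbed into the left factor. *)
Require Import Defs.
From mathcomp Require Import all_boot all_order all_algebra.

Set Implicit Arguments.
Unset Strict Implicit.
Unset Printing Implicit Defensive.

Import Order.TTheory GRing.Theory Num.Theory.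
Local Open Scope ring_scope.

Lemma unimodular_unitmx n (M : 'M[int]_n) : M \in unitmx -> unimodular M.
Proof. by rewrite unitmxE => /orP[] /eqP; [left | right]. Qed.

Lemma block_A_negqI_right_inverse k l (A : 'M[int]_(k, l)) (q : int) :
  exists X : 'M[int]_(k + l, k), block_A_negqI A q *m X = q%:M.
Proof.
(* The block [- 1%:M] meets [- q%:M] and the zero block kills [A]. *)
exists (castmx (addnC l k, erefl k) (col_mx 0 (- 1%:M))).
(* Eliminating the equality [addnC l k] turns both casts into identities. *)
rewrite /block_A_negqI; case: (k + l)%N / (addnC l k).
by rewrite !castmx_id mul_row_col mulmx0 add0r mulNmx mulmxN opprK mulmx1.
Qed.

(** Row [i] of the diagonal matrix has at most one nonzero entry, in column [lshift l i], so entry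
    [(i, i)] of the product is a single term. *)
Lemma rect_diag_dvd (R : comPzRingType) k l (d : nat -> R) (q : R)
    (Y : 'M[R]_(k + l, k)) :
    \matrix_(i < k, j < k + l) (d i *+ (i == j :> nat)) *m Y = q%:M ->
  forall i : 'I_k, d i * Y (lshift l i) i = q.
Proof.
move=> SY i; have /matrixP/(_ i i) := SY.
rewrite !mxE eqxx mulr1n (bigD1 (lshift l i)) //= mxE eqxx mulr1n.
rewrite big1 ?addr0 // => j /negPf nji.
by rewrite mxE eq_sym -[X in _ == X]/(val (lshift l i)) val_eqE nji mulr0n mul0r.
Qed.

Lemma rect_diagE (R : nmodType) k l (d : nat -> R) :
  \matrix_(i < k, j < k + l) (d i *+ (i == j :> nat))
    = row_mx (diag_mx (\row_(i < k) d i)) 0.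
Proof.
apply/matrixP => i j; rewrite !mxE; case: split_ordP => j' -> /=; rewrite !mxE //.
by rewrite ltn_eqF // (leq_trans (ltn_ord i)) // leq_addr.
Qed.

Lemma sorted_dvdz_nth (d : seq int) (i j : nat) :
  sorted dvdz d -> (i <= j)%N -> (d`_i %| d`_j)%Z.
Proof.
move=> sd le_ij; have [lt_jd|le_dj] := ltnP j (size d); last first.
  (* Past the end of [d] the default is 0, which every integer divides. *)
  by rewrite [d`_j]nth_default ?dvdz0.
have dvd_tr : transitive (dvdz : rel int) by move=> ? ? ?; apply: dvdz_trans.
apply: (sorted_leq_nth dvd_tr dvdzz 0 sd) => //.
by rewrite inE (leq_ltn_trans le_ij).
Qed.

Theorem proposition1 (p r k l : nat) (A : 'M[int]_(k, l))
    (p_prime : prime p) (r_gt0 : (0 < r)%N) (k_gt0 : (0 < k)%N)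
    (l_gt0 : (0 < l)%N) :
  exists (P : 'M[int]_k) (Q : 'M[int]_(k + l)) (e : 'I_k -> nat),
    [/\ unimodular P,
        unimodular Q,
        forall i j : 'I_k, (i <= j)%N -> (e i <= e j)%N
      & P *m block_A_negqI A (p%:Z ^+ r) *m Q
          = row_mx (diag_mx (\row_(i < k) p%:Z ^+ e i)) (0 : 'M[int]_(k, l))].
Proof.
set B := block_A_negqI _ _.
have [L uL [R uR [d sd eB]]] := int_Smith_normal_form B.
set D := \matrix_(i, j) _ in eB.
have [X BX] := block_A_negqI_right_inverse A (p%:Z ^+ r).
have DY : D *m (R *m X *m L) = (p%:Z ^+ r)%:M.
  (* After multiplication by [L] on the left, both sides equal [q L] with [q = p ^ r], since
     [L D R = B] and [B X = q I]. *)
  apply: (can_inj (mulKmx uL)).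
  by rewrite !mulmxA -eB BX scalar_mxC.
have dq := rect_diag_dvd DY.
(* The boolean equality lets [xchoose] extract the exponent as a function of [i]. *)
have dE (i : 'I_k) : exists n, absz (d`_i)%R == (p ^ n)%N.
  have : (absz (d`_i)%R %| p ^ r)%N.
    by rewrite -[p]/(absz p%:Z) -abszX -(dq i) abszM dvdn_mulr.
  by case/(dvdn_pfactor _ _ p_prime) => n _ ->; exists n.
pose e i := xchoose (dE i).
have eE (i : 'I_k) : absz (d`_i)%R = (p ^ e i)%N by apply/eqP/(xchooseP (dE i)).
(* The signs of the diagonal of [D]; as no [d_i] vanishes, [s] is its own inverse. *)
pose s : 'M[int]_k := diag_mx (\row_i Num.sg (d`_i)).
have d_neq0 (i : 'I_k) : d`_i != 0.
  by rewrite -absz_eq0 eE -lt0n expn_gt0 prime_gt0.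
have us : s \in unitmx.
  apply: (proj1 (mulmx1_unit (_ : s *m s = 1%:M))).
  rewrite mulmx_diag -diag_const_mx; congr diag_mx.
  by apply/rowP => i; rewrite !mxE -expr2 sqr_sg d_neq0.
exists (s *m invmx L), (invmx R), e; split.
- by apply: unimodular_unitmx; rewrite unitmx_mul us unitmx_inv.
- by apply: unimodular_unitmx; rewrite unitmx_inv.
- move=> i j le_ij; have := sorted_dvdz_nth sd le_ij.
  by rewrite dvdzE !eE dvdn_Pexp2l ?prime_gt1.
(* The product collapses to [s D], whose diagonal entries are [sg d_i * d_i = |d_i|]. *)
rewrite eB !mulmxA (mulmxKV uL) (mulmxK uR) /D rect_diagE mul_mx_row mulmx0.
congr row_mx; rewrite mulmx_diag; congr diag_mx.
apply/rowP => i; rewrite !mxE -normrEsg -abszE eE.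
by rewrite -natz natrX natz.
Qed.
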